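(* The $2$-abelian complexity of the Thue--Morse word is a concatenation of palindromes of increasing size, in the following sense: for every integer $q\ge 1$ the sequence \[\mathcal{P}_{2^q+1},\ \mathcal{P}_{2^q+2},\ \mathcal{P}_{2^q+3},\ \dots,\ \mathcal{P}_{2^{q+1}+1}\] is a palindrome, or equivalently \[\mathcal{P}_{2^q+1+i}=\mathcal{P}_{2^{q+1}+1-i}\qquad\text{for } 0\le i\le 2^{q-1}.\]
   Context: The infinite Thue--Morse word is $t=\lim_{n\to\infty} m^n(0)=0110100110010110\cdots$, where $m$ is the morphism $0\mapsto 01$, $1\mapsto 10$. $T_n$ denotes the set of (finite, contiguous) factors of $t$ of length $n$. For words $u,v$, $|u|_v$ is the number of occurrences of $v$ as a factor of $u$. Two words $u,v\in\{0,1\}^*$ are $2$-abelian equivalent, $u\equiv_2 v$, if their prefixes of length $1$ agree, their suffixes of length $1$ agree, and $|u|_w=|v|_w$ for every word $w$ of length $2$. $\mathcal{P}_n:=\#(T_n/{\equiv_2})$ is the number of $2$-abelian equivalence classes of factors of $t$ of length $n$. *)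

(* Defs.v *)
From mathcomp Require Import all_boot.
From mathcomp Require Import boolp.

Set Implicit Arguments.
Unset Strict Implicit.
Unset Printing Implicit Defensive.

(* The letters 0 and 1 are false and true; words are sequences of letters. *)
Definition word := seq bool.

Definition tm_letter (a : bool) : word := if a then [:: true; false] else [:: false; true].

Definition tm_morphism (u : word) : word := flatten (map tm_letter u).

Definition tm_iter (n : nat) : word := iter n tm_morphism [:: false].

(* Each [tm_iter n] has length [2 ^ n > n] and is a prefix of the next one, so
   letter [n] of the limit can be read off [tm_iter n]; see [thue_morse_limit]. *)
Definition thue_morse (n : nat) : bool := nth false (tm_iter n) n.

Lemma size_tm_iter n : size (tm_iter n) = 2 ^ n.
Proof.
rewrite /tm_iter; elim: n => // n IHn; rewrite iterS expnS -IHn.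
elim: (iter _ _ _) => //= a u; rewrite /tm_morphism /= size_cat => ->.
by case: a; rewrite mulnS.
Qed.

Lemma tm_iter_prefix n k : prefix (tm_iter n) (tm_iter (n + k)).
Proof.
have morph u v : prefix u v -> prefix (tm_morphism u) (tm_morphism v).
  by case/prefixP=> s ->; rewrite /tm_morphism map_cat flatten_cat prefix_prefix.
elim: n => [|n IHn]; last by rewrite addSn; exact: morph.
by elim: k => // k /morph; apply: prefix_trans.
Qed.

Lemma thue_morse_limit n i : i < 2 ^ n -> nth false (tm_iter n) i = thue_morse i.
Proof.
have agree m k : i < 2 ^ m ->
    nth false (tm_iter (m + k)) i = nth false (tm_iter m) i.
  move=> lt_im; have /prefixP[s ->] := tm_iter_prefix m k.
  by rewrite nth_cat size_tm_iter lt_im.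
by move=> lt_in; rewrite -(agree n i) // addnC agree // ltn_expl.
Qed.

Definition tm_factor (u : word) : Prop :=
  exists i, u = mkseq (fun j => thue_morse (i + j)) (size u).

Definition tm_factors (n : nat) : {set n.-tuple bool} :=
  [set u : n.-tuple bool | `[< tm_factor u >]].

Definition occurrences (v u : word) : nat :=
  count (fun i => prefix v (drop i u)) (iota 0 (size u).+1).

Definition equiv2 (u v : word) : bool :=
  [&& take 1 u == take 1 v,
      drop (size u - 1) u == drop (size v - 1) v
    & [forall w : 2.-tuple bool, occurrences w u == occurrences w v]].

Lemma equiv2_equivalence : equivalence_rel equiv2.
Proof.
move=> u v w; split; first by rewrite /equiv2 !eqxx; apply/forallP=> s; exact: eqxx.
case/and3P=> /eqP eq_p /eqP eq_s /forallP eq_w; rewrite /equiv2 eq_p eq_s.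
by congr [&& _, _ & _]; apply: eq_forallb => s; rewrite (eqP (eq_w s)).
Qed.

Definition complexity2 (n : nat) : nat :=
  #|equivalence_partition
      (fun u v : n.-tuple bool => equiv2 u v) (tm_factors n)|.

Definition palindrome (T : Type) (s : seq T) : Prop := rev s = s.

(* Main.v *)
Require Import Defs.
From mathcomp Require Import all_boot.
From mathcomp Require Import boolp zify.

Set Implicit Arguments.
Unset Strict Implicit.
Unset Printing Implicit Defensive.

(** Let [c(i, m)] be the number of letter changes in the window [t_i ... t_(i+m)]
    of the Thue-Morse word [t], and let [n = m + 1] be its length.

    The 2-abelian class of such a window is given by its first letter, by
    [c(i, m)] and, exactly when [m + c(i, m)] is odd, by the parity of [i]
    ([equiv2_window]).  Indeed the first letter and [c] give the last letter and
    the numbers of factors 01 and 10, so that only the number of ones remains;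
    cutting [t] into the blocks 01 and 10, each of which contains a single one,
    expresses that number through the end letters and the parities of [i] and
    [m] ([ones_parity]).

    Inside a block the letter always changes, and between two consecutive blocks
    it changes exactly when the two corresponding letters of [t] agree.  Hence
    the changes of a window and those of the half as long window it comes from
    have a fixed sum ([changes_even2] and its three companions).  Write
    [m' = 3 * 2 ^ q - m], a reflection that exchanges the ends of the interval
    from [2 ^ q] to [2 ^ (q + 1)].  By induction on [q], every value [c] of
    [c(_, m)] has a mirror value [2 ^ (q + 1) - c] of [c(_, m')]
    ([changes_reflect]): when both windows are halved, [m] and [m'] become again
    a reflected pair provided that their starting positions have opposite
    parities, which is what an odd [m] requires.

    For [q >= 1] the reflection thus preserves the parity of [m + c], flips that
    of [i], and the first letter can be kept because the set of factors is closed
    under complement ([window_complement]).  It therefore sends inequivalent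
    windows of length [m + 1] to inequivalent windows of length [m' + 1]; since
    [m'' = m], both lengths have the same number of classes
    ([complexity2_reflect]). *)

(** * The Thue-Morse word *)

Lemma nth_tm_morphism (u : word) i : i < size u ->
  nth false (tm_morphism u) i.*2 = nth false u i /\
  nth false (tm_morphism u) i.*2.+1 = ~~ nth false u i.
Proof. by elim: u i => [|[] u IHu] [|i] //= /IHu. Qed.

Lemma thue_morse_doubling i :
  thue_morse i.*2 = thue_morse i /\ thue_morse i.*2.+1 = ~~ thue_morse i.
Proof.
have lt_i : i < 2 ^ i by apply: ltn_expl.
have [] := @nth_tm_morphism (tm_iter i) i; first by rewrite size_tm_iter.
rewrite -[tm_morphism _]/(tm_iter i.+1) !thue_morse_limit // ?expnS; lia.
Qed.

Lemma thue_morse_even i : thue_morse i.*2 = thue_morse i.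
Proof. by have [] := thue_morse_doubling i. Qed.

Lemma thue_morse_odd i : thue_morse i.*2.+1 = ~~ thue_morse i.
Proof. by have [] := thue_morse_doubling i. Qed.

Lemma thue_morse_shift N i : i < 2 ^ N -> thue_morse (2 ^ N + i) = ~~ thue_morse i.
Proof.
elim: N i => [|N IHN] i; first by case: i.
rewrite expnS => lt_i.
have lt_half : i./2 < 2 ^ N by lia.
rewrite -(odd_double_half i); case: (odd i).
  have -> : 2 * 2 ^ N + (1 + i./2.*2) = (2 ^ N + i./2).*2.+1 by lia.
  by rewrite add1n !thue_morse_odd IHN.
have -> : 2 * 2 ^ N + (0 + i./2.*2) = (2 ^ N + i./2).*2 by lia.
by rewrite add0n !thue_morse_even IHN.
Qed.

(** * Letter changes and their reflection *)

Definition changes i m : nat :=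
  \sum_(l < m) (thue_morse (i + l) (+) thue_morse (i + l).+1).

(** The [k] blocks contribute [k] changes, and each of the [k] block boundaries
    contributes a change exactly when the underlying letters of [t] do not
    change. *)
Lemma changes_even2 i k : changes i.*2 k.*2 + changes i k = k.*2.
Proof.
elim: k => [|k IHk]; rewrite /changes ?big_ord0 // doubleS !big_ord_recr /= -!/(changes _ _).
rewrite addnS -doubleD -doubleS !thue_morse_even thue_morse_odd.
by move: IHk; do 2 case: (thue_morse _); rewrite /=; lia.
Qed.

Lemma changesSr i m :
  changes i m.+1 = changes i m + (thue_morse (i + m) (+) thue_morse (i + m).+1).
Proof. by rewrite /changes big_ord_recr. Qed.

Lemma changesSl i m :
  changes i m.+1 = (thue_morse i (+) thue_morse i.+1) + changes i.+1 m.
Proof.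
rewrite /changes big_ord_recl addn0; congr (_ + _).
by apply: eq_bigr => l _; rewrite addSnnS.
Qed.

Lemma changes_evenS i k : changes i.*2 k.*2.+1 + changes i k = k.*2.+1.
Proof.
have := changes_even2 i k; rewrite changesSr -doubleD thue_morse_even thue_morse_odd.
by case: (thue_morse _); rewrite /=; lia.
Qed.

(** The first and the last of the pairs of consecutive letters straddle a block
    boundary, so the window meets [k + 1] boundaries but only [k] full blocks. *)
Lemma changes_oddS i k : changes i.*2.+1 k.*2.+1 + changes i k.+1 = k.*2.+1.
Proof.
have := changes_even2 i k.+1; rewrite doubleS changesSl thue_morse_even thue_morse_odd.
by case: (thue_morse _); rewrite /=; lia.
Qed.

Lemma changes_odd2 i k : changes i.*2.+1 k.*2 + changes i k = k.*2.
Proof.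
have := changes_evenS i k; rewrite changesSl thue_morse_even thue_morse_odd.
by case: (thue_morse _); rewrite /=; lia.
Qed.

(** For [m] even, [m] and its mirror image are twice a reflected pair.  For [m]
    odd, say [m = 2 k + 1], they are one more than twice [k] and [3 * 2 ^ q - k.+1],
    which is not a reflected pair; it becomes one if exactly one of the two indices
    is raised by one, that is, if exactly one of the two windows starts at an odd
    position. *)
Lemma changes_reflect_opposite q :
  (forall m i, 2 ^ q <= m <= 2 ^ q.+1 ->
     exists j, changes j (3 * 2 ^ q - m) + changes i m = 2 ^ q.+1) ->
  forall m i, 2 ^ q.+1 <= m <= 2 ^ q.+2 ->
    exists2 j, odd j = ~~ odd i &
      changes j (3 * 2 ^ q.+1 - m) + changes i m = 2 ^ q.+2.
Proof.
move=> reflect m i; rewrite -(odd_double_half m) -(odd_double_half i).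
rewrite !expnS; set Q := 2 ^ q in reflect *; set k := m./2; set i0 := i./2.
rewrite expnS -/Q in reflect.
case: (odd m); case: (odd i); rewrite ?add1n ?add0n => bnd_m.
- have [|j Hj] := reflect k.+1 i0; first lia.
  exists j.*2; first lia.
  have -> : 3 * (2 * Q) - k.*2.+1 = (3 * Q - k.+1).*2.+1 by lia.
  by have := changes_evenS j (3 * Q - k.+1); have := changes_oddS i0 k; lia.
- have [|j Hj] := reflect k i0; first lia.
  exists j.*2.+1; first lia.
  have -> : 3 * (2 * Q) - k.*2.+1 = (3 * Q - k).-1.*2.+1 by lia.
  have := changes_oddS j (3 * Q - k).-1.
  rewrite prednK; last lia.
  by have := changes_evenS i0 k; lia.
- have [|j Hj] := reflect k i0; first lia.
  exists j.*2; first lia.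
  have -> : 3 * (2 * Q) - k.*2 = (3 * Q - k).*2 by lia.
  by have := changes_even2 j (3 * Q - k); have := changes_odd2 i0 k; lia.
- have [|j Hj] := reflect k i0; first lia.
  exists j.*2.+1; first lia.
  have -> : 3 * (2 * Q) - k.*2 = (3 * Q - k).*2 by lia.
  by have := changes_odd2 j (3 * Q - k); have := changes_even2 i0 k; lia.
Qed.

Lemma changes1 i : changes i 1 = thue_morse i (+) thue_morse i.+1.
Proof. by rewrite /changes big_ord1 addn0. Qed.

Lemma changes_reflect q m i : 2 ^ q <= m <= 2 ^ q.+1 ->
  exists j, changes j (3 * 2 ^ q - m) + changes i m = 2 ^ q.+1.
Proof.
elim: q m i => [|q IHq] m i; last first.
  by move=> /(changes_reflect_opposite IHq i)[j _]; exists j.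
rewrite expn0 expn1 => bnd_m.
have [-> | ->] : m = 1 \/ m = 2 by lia.
  (* The changes of [t = 011010...] start with 1, 0, 1, 1, 1. *)
  have [zero | one] : changes i 1 = 0 \/ changes i 1 = 1.
  - by rewrite changes1; case: (_ (+) _); [right | left].
  - by exists 2; rewrite zero /changes !big_ord_recl big_ord0.
  - by exists 0; rewrite one /changes !big_ord_recl big_ord0.
(* One of two consecutive pairs of letters is a block and contributes a change. *)
have [one | two] : changes i 2 = 1 \/ changes i 2 = 2.
- rewrite -(odd_double_half i); have := changes1 i./2.
  have := changes_even2 i./2 1; have := changes_odd2 i./2 1.
  by rewrite -[1.*2]/2; case: (odd i); case: (_ (+) _); rewrite ?add0n ?add1n /=; lia.
- by exists 0; rewrite one /changes !big_ord_recl big_ord0.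
- by exists 1; rewrite two /changes !big_ord_recl big_ord0.
Qed.

(** For large [N] the factor at position [2 ^ N + i] is the complement of the one
    at [i]. *)
Lemma window_complement i m : exists2 j, odd j = odd i &
  thue_morse j = ~~ thue_morse i /\ changes j m = changes i m.
Proof.
pose N := (i + m).+1.
have lt_N : N < 2 ^ N by apply: ltn_expl.
exists (2 ^ N + i); first by rewrite oddD oddX.
split; first by rewrite thue_morse_shift //; lia.
apply: eq_bigr => l _; have lt_l := ltn_ord l.
by rewrite -addnS -!addnA !thue_morse_shift ?addnS; lia.
Qed.

(** * The 2-abelian class of a window *)

Definition window i n : word := mkseq (fun j => thue_morse (i + j)) n.

Definition pair_count x y i m : nat :=
  \sum_(l < m) ((thue_morse (i + l) == x) && (thue_morse (i + l).+1 == y)).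

(** Only the first [m] letters of the window are counted, so that a one is always
    followed by a letter of the window and starts a factor 10 or 11. *)
Definition ones i m : nat := \sum_(l < m) thue_morse (i + l).

Lemma window_cons i n : window i n.+1 = thue_morse i :: window i.+1 n.
Proof.
rewrite /window /mkseq /= addn0 -[1%N]addn0 iotaDl -map_comp.
by congr (_ :: _); apply: eq_map => j /=; rewrite addnS.
Qed.

Lemma occurrences_cons v a (u : word) :
  occurrences v (a :: u) = prefix v (a :: u) + occurrences v u.
Proof.
rewrite /occurrences /=; congr (_ + _).
by rewrite -[2%N]/(1 + 1) -[1%N in LHS]/(1 + 0) (iotaDl 1 1) -/(iota 0 _) count_map.
Qed.

Lemma occurrences_window x y i m :
  occurrences [:: x; y] (window i m.+1) = pair_count x y i m.
Proof.
elim: m i => [|m IHm] i; first by rewrite /pair_count big_ord0 /occurrences /= andbF.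
rewrite window_cons occurrences_cons IHm window_cons.
rewrite /pair_count big_ord_recl /= addn0 prefix0s andbT.
rewrite ![_ == thue_morse _]eq_sym; congr (_ + _).
by apply: eq_bigr => l _; rewrite addSnnS.
Qed.

(** The window splits into blocks 01 and 10, with one letter 1 each, up to a
    leading letter when [i] is odd and a trailing one according to the parity of
    [i + m].  The trailing letter is [t_(i+m-1)], the complement of
    [t_(i+m)] in its block or absent, which is why [t_(i+m)] appears on the
    left. *)
Lemma ones_parity i m : ones i m + thue_morse (i + m) * (odd m (+) odd i) =
  m./2 + (odd m && ~~ odd i) + thue_morse i * odd i.
Proof.
elim: m => [|m IHm]; first by rewrite /ones big_ord0 addn0 mulnC.
have step : ones i m.+1 = ones i m + thue_morse (i + m) by rewrite /ones big_ord_recr.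
have pairing : ~~ odd (i + m) -> thue_morse (i + m).+1 = ~~ thue_morse (i + m).
  move=> ev; rewrite -(odd_double_half (i + m)) (negbTE ev).
  by rewrite thue_morse_odd thue_morse_even.
move: IHm pairing; rewrite step addnS oddD /= uphalf_half.
case: (odd i); case: (odd m) => /= IHm; [move/(_ isT) ->|move=> _|move=> _|move/(_ isT) ->];
  move: IHm; case: (thue_morse (i + m)); case: (thue_morse i) => /=; lia.
Qed.

(** The relations that reduce the four factor counts to [changes] and [ones]: in
    particular 01 and 10 alternate along the window, so that their counts differ
    by at most one, as prescribed by the end letters. *)
Lemma pair_counts i m :
  [/\ pair_count false false i m + changes i m + pair_count true true i m = m,
      pair_count false true i m + pair_count true false i m = changes i m,
      pair_count false true i m + thue_morse i =
        pair_count true false i m + thue_morse (i + m),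
      pair_count true false i m + pair_count true true i m = ones i m &
      thue_morse (i + m) = thue_morse i (+) odd (changes i m)].
Proof.
elim: m => [|m [IH1 IH2 IH3 IH4 IH5]].
  by rewrite /pair_count /changes /ones !big_ord0 !addn0 /= addbF.
rewrite /pair_count /changes /ones !big_ord_recr /= -!/(pair_count _ _ _ _).
rewrite -/(changes _ _) -/(ones _ _) oddD addbA addnS -IH5 oddb.
move: IH1 IH2 IH3 IH4.
by case: (thue_morse (i + m)); case: (thue_morse (i + m).+1) => /= *; split=> //; lia.
Qed.

(** When [m] and the number of changes have the same parity, the formula of
    [ones_parity] takes the same value for even and for odd starting positions;
    otherwise the two values differ. *)
Lemma eq_ones i j m :
  thue_morse i = thue_morse j -> changes i m = changes j m ->
  (ones i m == ones j m) = (odd (m + changes i m) ==> (odd i == odd j)).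
Proof.
have [_ _ _ _ last_i] := pair_counts i m; have [_ _ _ _ last_j] := pair_counts j m.
move=> eq_first eq_c; have := ones_parity i m; have := ones_parity j m.
rewrite last_i last_j eq_first eq_c oddD; clear.
move: (ones i m) (ones j m) m./2 => zi zj h.
by case: (odd m); case: (odd (changes j m)); case: (odd i); case: (odd j);
  case: (thue_morse j) => /= Zj Zi; lia.
Qed.

Lemma equiv2_window i j m :
  equiv2 (window i m.+1) (window j m.+1) =
  [&& thue_morse i == thue_morse j, changes i m == changes j m &
      odd (m + changes i m) ==> (odd i == odd j)].
Proof.
have last_window k : drop (size (window k m.+1) - 1) (window k m.+1) =
    [:: thue_morse (k + m)].
  rewrite size_mkseq subn1 /= /window mkseqS -cats1.
  by rewrite drop_size_cat ?size_mkseq.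
rewrite /equiv2 !last_window !window_cons /= !take0 -!window_cons.
have -> : [forall w : 2.-tuple bool,
    occurrences w (window i m.+1) == occurrences w (window j m.+1)] =
  [forall w : 2.-tuple bool,
    pair_count (tnth w ord0) (tnth w ord_max) i m ==
    pair_count (tnth w ord0) (tnth w ord_max) j m].
  apply: eq_forallb => w; rewrite -!occurrences_window.
  by case/tupleP: w => x w; case/tupleP: w => y w; rewrite [w]tuple0.
have [i1 i2 i3 i4 i5] := pair_counts i m; have [j1 j2 j3 j4 j5] := pair_counts j m.
rewrite eqseq_cons andbT; apply/and3P/and3P.
  case=> /eqP eq_first /eqP[eq_last] /forallP eq_count.
  have := eq_count [tuple true; true]; have := eq_count [tuple false; false].
  rewrite !(tnth_nth false) /= => /eqP eq00 /eqP eq11.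
  have eq_c : changes i m = changes j m by clear -i1 j1 eq00 eq11; lia.
  split; [exact/eqP | exact/eqP |].
  rewrite -eq_ones //; apply/eqP.
  by clear -i2 j2 i3 j3 i4 j4 eq_first eq_last eq_c eq11; lia.
case=> /eqP eq_first /eqP eq_c; rewrite -eq_ones // => /eqP eq_z.
have eq_last : thue_morse (i + m) = thue_morse (j + m) by rewrite i5 j5 eq_first eq_c.
split; [by rewrite eq_first | by rewrite eq_last |].
rewrite eq_first eq_last in i3; apply/forallP=> w.
by case: (tnth w _); case: (tnth w _); apply/eqP;
  clear -i1 j1 i2 j2 i3 j3 i4 j4 eq_c eq_z; lia.
Qed.

(** * Reflection of the complexity *)

(** The map [h] sends the points of a transversal for [R1] to pairwise
    inequivalent points for [R2]. *)
Lemma card_equivalence_partition_le (T1 T2 : finType) (R1 : rel T1) (R2 : rel T2)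
    (D1 : {set T1}) (D2 : {set T2}) (h : T1 -> T2) :
  equivalence_rel R1 -> equivalence_rel R2 ->
  {in D1, forall x, h x \in D2} ->
  {in D1 &, forall x y, R2 (h x) (h y) -> R1 x y} ->
  #|equivalence_partition R1 D1| <= #|equivalence_partition R2 D2|.
Proof.
move=> eqR1 eqR2 hD hR.
have eqR1D : {in D1 & &, equivalence_rel R1} by move=> x y z _ _ _; apply: eqR1.
have eqR2D : {in D2 & &, equivalence_rel R2} by move=> x y z _ _ _; apply: eqR2.
have part1 := equivalence_partitionP eqR1D.
have part2 := equivalence_partitionP eqR2D.
have trX := transversalP part1; set X := transversal _ _ in trX.
have XD := subsetP (transversal_sub trX).
have triv1 := partition_trivIset part1; have triv2 := partition_trivIset part2.
have cover1 := cover_partition part1; have cover2 := cover_partition part2.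
rewrite -(card_transversal trX).
rewrite -(@card_in_imset _ _ (fun x => pblock (equivalence_partition R2 D2) (h x))).
  apply/subset_leq_card/subsetP=> _ /imsetP[x /XD Dx ->].
  by apply: pblock_mem; rewrite cover2 hD.
move=> x y Xx Xy /= eq_h; have [Dx Dy] := (XD _ Xx, XD _ Xy).
apply: (pblock_inj trX) => //; apply/eqP.
rewrite eq_pblock ?cover1 // pblock_equivalence_partition //.
apply: hR => //; rewrite -(pblock_equivalence_partition eqR2D) ?hD //.
by rewrite eq_h mem_pblock cover2 hD.
Qed.

(** Send a window at [i] to a window at [j] with the same first letter, mirrored
    number of changes and opposite parity of the position: these data determine
    the data of the original window. *)
Lemma complexity2_reflect_le q m : 1 <= q -> 2 ^ q <= m <= 2 ^ q.+1 ->
  complexity2 m.+1 <= complexity2 (3 * 2 ^ q - m).+1.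
Proof.
case: q => // q _ bnd_m; set m' := 3 * _ - m.
have reflect i : exists j, [/\ thue_morse j = thue_morse i, odd j = ~~ odd i &
    changes j m' + changes i m = 2 ^ q.+2].
  have [j odd_j refl_j] := changes_reflect_opposite (@changes_reflect q) i bnd_m.
  (* Complementing the mirror window restores the first letter if needed. *)
  have [eq_a | neq_a] := eqVneq (thue_morse j) (thue_morse i); first by exists j.
  have [k odd_k [a_k c_k]] := window_complement j m'.
  exists k; split; [|by rewrite odd_k|by rewrite c_k].
  by move: a_k neq_a; do 3 case: (thue_morse _).
have position (u : m.+1.-tuple bool) : exists i, u \in tm_factors m.+1 ->
    u = window i m.+1 :> word.
  have [|notin_u] := boolP (u \in tm_factors m.+1); last by exists 0.
  by rewrite inE => /asboolP[i eq_u]; exists i; rewrite {1}eq_u size_tuple.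
have [pos posP] := choice position; have [mirror mirrorP] := choice reflect.
have size_window i : size (window i m'.+1) == m'.+1 by rewrite size_mkseq.
have equivR n : equivalence_rel (fun u v : n.-tuple bool => equiv2 u v).
  by move=> u v w; apply: equiv2_equivalence.
apply: (card_equivalence_partition_le
  (h := fun u => Tuple (size_window (mirror (pos u)))) (equivR _) (equivR _)).
  move=> u _; rewrite inE; apply/asboolP.
  by exists (mirror (pos u)); rewrite size_tuple.
move=> u v Du Dv /=; rewrite (posP _ Du) (posP _ Dv) !equiv2_window.
have [-> odd_u refl_u] := mirrorP (pos u); have [-> odd_v refl_v] := mirrorP (pos v).
case/and3P=> -> /eqP eq_c; rewrite odd_u odd_v.
have -> : odd (m' + changes (mirror (pos u)) m') = odd (m + changes (pos u) m).
  (* [m + m'] and the total number of changes are both even. *)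
  have : m' + m = 3 * 2 ^ q.+1 by rewrite /m'; move: bnd_m; rewrite [2 ^ q.+2]expnS; lia.
  by move: refl_u; rewrite !expnS; lia.
rewrite (inj_eq negb_inj) => ->; rewrite andbT; apply/eqP; lia.
Qed.

Lemma complexity2_reflect q m : 1 <= q -> 2 ^ q <= m <= 2 ^ q.+1 ->
  complexity2 m.+1 = complexity2 (3 * 2 ^ q - m).+1.
Proof.
move=> q_gt0 bnd_m; apply/eqP; rewrite eqn_leq complexity2_reflect_le //=.
have bnd_m' : 2 ^ q <= 3 * 2 ^ q - m <= 2 ^ q.+1 by move: bnd_m; rewrite expnS; lia.
have := complexity2_reflect_le q_gt0 bnd_m'; rewrite subKn //.
by move: bnd_m; rewrite expnS; lia.
Qed.

Theorem theorem7p3 (q : nat) (hq : 1 <= q) :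
  palindrome [seq complexity2 n | n <- index_iota (2 ^ q + 1) (2 ^ q.+1 + 2)] /\
  (forall i : nat, i <= 2 ^ (q - 1) ->
     complexity2 (2 ^ q + 1 + i) = complexity2 (2 ^ q.+1 + 1 - i)).
Proof.
have mirror i : i <= 2 ^ q ->
    complexity2 (2 ^ q + 1 + i) = complexity2 (2 ^ q.+1 + 1 - i).
  move=> le_i; have := @complexity2_reflect q (2 ^ q + i) hq.
  rewrite addn1 addSn expnS => ->; last lia.
  by congr complexity2; lia.
split; last first.
  by move=> i le_i; apply: mirror; apply: leq_trans le_i _; rewrite leq_exp2l // leq_subr.
rewrite /palindrome; apply: (@eq_from_nth _ 0); first by rewrite size_rev.
move=> i; rewrite size_rev size_map size_iota => lt_i.
rewrite nth_rev size_map size_iota // !(nth_map 0) ?size_iota; try lia.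
rewrite !nth_iota; try lia.
move: lt_i (@mirror i); rewrite expnS => lt_i ->; last lia.
by congr complexity2; lia.
Qed.
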